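(* Let $\mathcal{B}=\{0,1\}^{\mathbb{Z}}$ be the set of bi-infinite binary sequences with the quandle structure $(\mathcal{B},\blacktriangleright)$ described in the context, with inverse quandle operation $\blacktriangleleft$, and let $\sim$ be the equivalence relation on $\mathcal{B}$ defined by $a\sim b$ if and only if $a_i=b_i$ for all $i\geq 0$. Then $\sim$ is a $\blacktriangleright$-congruence on $\mathcal{B}$ that is not a $\blacktriangleleft$-congruence.
   Context: Let $\ell,r:\mathcal{B}\to\mathcal{B}$ be the left- and right-shift operators $(\ell(a))_i=a_{i+1}$ and $(r(a))_i=a_{i-1}$; these are mutually inverse bijections. Let $\simeq$ be the equivalence relation on $\mathcal{B}$ defined by $a\simeq b$ if and only if there exist $s,t\in\mathbb{Z}$ such that $\ell^s(a)\sim\ell^t(b)$, where $a\sim b$ means $a_i=b_i$ for all $i\ge 0$. Define binary operations on $\mathcal{B}$ by: $a\blacktriangleright b=a$ if $a\simeq b$ and $a\blacktriangleright b=\ell(a)$ if $a\not\simeq b$; $a\blacktriangleleft b=a$ if $a\simeq b$ and $a\blacktriangleleft b=r(a)$ if $a\not\simeq b$. Then $(\mathcal{B},\blacktriangleright)$ is a quandle (i.e. $\blacktriangleright$ is idempotent, right self-distributive and right invertible) with inverse operation $\blacktriangleleft$, meaning $(a\blacktriangleright b)\blacktriangleleft b=a=(a\blacktriangleleft b)\blacktriangleright b$. For a binary operation $*$ on a set $M$, an equivalence relation $\sim$ on $M$ is a $*$-congruence if $a\sim c$ and $b\sim d$ imply $a*b\sim c*d$, for all $a,b,c,d\in M$.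 *)

(* Defs.v *)
(* [boolp] provides the classical decision [`[< P >]] of a proposition. *)
From mathcomp Require Import all_boot all_order all_algebra.
From mathcomp Require Import boolp.
From Stdlib Require Import RelationClasses.

Set Implicit Arguments.
Unset Strict Implicit.
Unset Printing Implicit Defensive.

Import Order.TTheory GRing.Theory Num.Theory.
Local Open Scope ring_scope.

(* [inv] is the inverse operation witnessing right invertibility of [op];
   [left_distributive op op] reads (a * b) * c = (a * c) * (b * c), which
   quandle theory calls right self-distributivity. *)
Record is_quandle (M : Type) (op inv : M -> M -> M) : Prop := IsQuandle {
  quandle_idem : forall a, op a a = a;
  quandle_dist : left_distributive op op;
  quandle_opK : forall b, cancel (op^~ b) (inv^~ b);
  quandle_invK : forall b, cancel (inv^~ b) (op^~ b)
}.

Definition is_congruence (M : Type) (op : M -> M -> M) (R : M -> M -> Prop) :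
    Prop :=
  Equivalence R /\
  forall a b c d : M, R a c -> R b d -> R (op a b) (op c d).

Definition biseq : Type := int -> bool.

Definition lshift (a : biseq) : biseq := fun i => a (i + 1).
Definition rshift (a : biseq) : biseq := fun i => a (i - 1).

(* The integer power l^s, where l^(-n) is the n-th iterate of r = l^(-1);
   [Negz n] denotes -(n+1). *)
Definition lshiftz (s : int) : biseq -> biseq :=
  match s with
  | Posz n => iter n lshift
  | Negz n => iter n.+1 rshift
  end.

Definition nneg_eq (a b : biseq) : Prop := forall i : int, 0 <= i -> a i = b i.

Definition shift_eq (a b : biseq) : Prop :=
  exists s t : int, nneg_eq (lshiftz s a) (lshiftz t b).

Definition rtri (a b : biseq) : biseq :=
  if `[< shift_eq a b >] then a else lshift a.
Definition ltri (a b : biseq) : biseq :=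
  if `[< shift_eq a b >] then a else rshift a.

Lemma lshiftK : cancel lshift rshift.
Proof. by move=> a; apply/funext => i; rewrite /lshift /rshift subrK. Qed.

Lemma rshiftK : cancel rshift lshift.
Proof. by move=> a; apply/funext => i; rewrite /lshift /rshift addrK. Qed.

Lemma lshiftzE s a i : lshiftz s a i = a (i + s).
Proof.
case: s => n /=.
  elim: n i => [|n IHn] i /=; first by rewrite addr0.
  by rewrite /lshift IHn intS addrA.
rewrite NegzE -[rshift _]/(iter n.+1 rshift a).
elim: n.+1 i => [|k IHk] i /=; first by rewrite oppr0 addr0.
by rewrite /rshift IHk intS opprD addrA.
Qed.

Lemma nneg_eq_equiv : Equivalence nneg_eq.
Proof.
split=> [a i _ //|a b ab i i0|a b c ab bc i i0]; first by rewrite ab.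
by rewrite ab ?bc.
Qed.

Lemma shift_eq_equiv : Equivalence shift_eq.
Proof.
split=> [a|a b [s [t st]]|a b c [s [t st]] [u [v uv]]].
- by exists 0, 0.
- by exists t, s => i i0; rewrite st.
have [tu|ut] := leP t u.
  exists (s + (u - t)), v => i i0; rewrite -uv // !lshiftzE.
  have j0 : 0 <= i + (u - t) by rewrite addr_ge0 ?subr_ge0.
  have := st _ j0; rewrite !lshiftzE -addrA (addrC (u - t)) => ->.
  by rewrite -addrA subrK.
exists s, (v + (t - u)) => i i0; rewrite st // !lshiftzE.
have j0 : 0 <= i + (t - u) by rewrite addr_ge0 // subr_ge0 ltW.
have := uv _ j0; rewrite !lshiftzE -(addrA i) subrK => ->.
by rewrite -addrA (addrC (t - u)).
Qed.

Lemma shift_eq_lshift a : shift_eq (lshift a) a.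
Proof. by exists 0, 1. Qed.

Lemma shift_eq_rshift a : shift_eq (rshift a) a.
Proof. by exists 0, (- 1). Qed.

Lemma shift_eq_rtri a b : shift_eq (rtri a b) a.
Proof.
rewrite /rtri; case: ifP => _; last exact: shift_eq_lshift.
by case: shift_eq_equiv.
Qed.

Lemma shift_eq_ltri a b : shift_eq (ltri a b) a.
Proof.
rewrite /ltri; case: ifP => _; last exact: shift_eq_rshift.
by case: shift_eq_equiv.
Qed.

Lemma shift_eq_congr a a' b b' :
  shift_eq a' a -> shift_eq b' b -> `[< shift_eq a' b' >] = `[< shift_eq a b >].
Proof.
have [_ sym trans] := shift_eq_equiv => aa bb.
apply: asbool_equiv_eq; split=> [ab|ab].
  exact: trans _ _ _ (sym _ _ aa) (trans _ _ _ ab bb).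
exact: trans _ _ _ aa (trans _ _ _ ab (sym _ _ bb)).
Qed.

Lemma biseq_quandle : is_quandle rtri ltri.
Proof.
have [refl _ _] := shift_eq_equiv.
split=> [a|a b c|b a|b a] /=.
- by rewrite /rtri asboolT.
- have rtriE x y : rtri x y = if `[< shift_eq x y >] then x else lshift x by [].
  rewrite (rtriE (rtri a b)) (rtriE (rtri a c)).
  rewrite (shift_eq_congr (shift_eq_rtri a b) (refl c)).
  rewrite (shift_eq_congr (shift_eq_rtri a c) (shift_eq_rtri b c)).
  by rewrite !rtriE; case: ifP => ac; case: ifP => ab.
- rewrite {1}/ltri (shift_eq_congr (shift_eq_rtri a b) (refl b)) /rtri.
  by case: `[< shift_eq a b >] => /=; rewrite ?lshiftK.
- rewrite {1}/rtri (shift_eq_congr (shift_eq_ltri a b) (refl b)) /ltri.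
  by case: `[< shift_eq a b >] => /=; rewrite ?rshiftK.
Qed.

(* Main.v *)
From mathcomp Require Import all_boot all_order all_algebra.
From mathcomp Require Import boolp.
Require Import Defs.

Import Order.TTheory GRing.Theory Num.Theory.
Local Open Scope ring_scope.

(** Agreement on the nonnegative indices is finer than eventual agreement up
    to shifts, and the latter is an equivalence relation.  Hence replacing [a]
    and [b] by sequences that agree with them on the nonnegative indices does
    not change which branch the two quandle operations take
    ([asbool_shift_eq_congr]).  What remains is whether the shift itself
    respects the relation.  The left shift does, because it reads an entry of
    nonnegative index off an entry of nonnegative index.  The right shift does
    not, because it moves the unconstrained entry of index [-1] to index [0]:
    the zero sequence and the sequence whose only nonzero entry has index [-1]
    agree on the nonnegative indices, but their right shifts differ at [0].
    Acting on both by the constant sequence 1, which has no shift eventually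
    equal to a shift of the zero sequence, makes the inverse operation perform
    that right shift. *)

Lemma nneg_eq_shift_eq a b : nneg_eq a b -> shift_eq a b.
Proof. by move=> ab; exists 0, 0. Qed.

Lemma asbool_shift_eq_congr a b c d :
  nneg_eq a c -> nneg_eq b d -> `[< shift_eq a b >] = `[< shift_eq c d >].
Proof. by move=> ac bd; apply: shift_eq_congr; apply: nneg_eq_shift_eq. Qed.

Lemma nneg_eq_lshift a b : nneg_eq a b -> nneg_eq (lshift a) (lshift b).
Proof. by move=> ab i i0; rewrite /lshift ab // addr_ge0. Qed.

Lemma rtri_congruence : is_congruence rtri nneg_eq.
Proof.
split=> [|a b c d ac bd]; first exact: nneg_eq_equiv.
rewrite /rtri (asbool_shift_eq_congr _ _ _ _ ac bd).
by case: ifP => _ //; apply: nneg_eq_lshift.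
Qed.

Lemma not_shift_eq_const x y : x != y -> ~ shift_eq (fun=> x) (fun=> y).
Proof.
move=> /eqP xy [s [t /(_ 0 (lexx 0))]].
by rewrite !lshiftzE.
Qed.

Lemma ltri_not_congruence : ~ is_congruence ltri nneg_eq.
Proof.
pose zero : biseq := fun=> false.
pose one : biseq := fun=> true.
pose spike : biseq := fun i => i == -1.
case=> _ ltri_congr.
have zero_spike : nneg_eq zero spike by case.
have one_one : nneg_eq one one by [].
have zero_one : `[< shift_eq zero one >] = false.
  exact/asboolF/not_shift_eq_const.
have spike_one : `[< shift_eq spike one >] = false.
  by rewrite -(asbool_shift_eq_congr _ _ _ _ zero_spike one_one).
have := ltri_congr _ _ _ _ zero_spike one_one 0 (lexx 0).
by rewrite /ltri zero_one spike_one.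
Qed.

Theorem proposition5p2 :
  is_congruence rtri nneg_eq /\ ~ is_congruence ltri nneg_eq.
Proof.
split; first exact: rtri_congruence.
exact: ltri_not_congruence.
Qed.
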